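(* Let $X$ be a connected, finite-type CW-complex. Suppose $H_1(X,\mathbb{Z})$ has no $2$-torsion. Then $\mathcal{R}^1_s(X,\mathbb{Z}_2)=\widetilde{\mathcal{R}}^1_s(X,\mathbb{Z}_2)$ for all $s\ge0$.
   Context: Put $A=H^\bullet(X,\mathbb{Z}_2)$ with cup product, and let $\beta_2=\mathrm{Sq}^1\colon A^q\to A^{q+1}$ be the Bockstein operator, i.e. the coboundary map of the coefficient sequence $0\to\mathbb{Z}_2\to\mathbb{Z}_4\to\mathbb{Z}_2\to0$. Usual resonance varieties: when $H_1(X,\mathbb{Z})$ has no $2$-torsion one has $a^2=0$ for all $a\in A^1$. With $\delta_a(u)=au$, define $\mathcal{R}^q_s(X,\mathbb{Z}_2)=\{a\in H^1(X,\mathbb{Z}_2)\mid\dim_{\mathbb{Z}_2}H^q(A,\delta_a)\ge s\}$. Bockstein resonance varieties: with $\tilde\delta_a(u)=au+\beta_2(u)$ (which satisfies $\tilde\delta_a\circ\tilde\delta_a=0$ because $\beta_2(a)=a^2$), define $\widetilde{\mathcal{R}}^q_s(X,\mathbb{Z}_2)=\{a\in H^1(X,\mathbb{Z}_2)\mid\dim_{\mathbb{Z}_2}H^q(A,\tilde\delta_a)\ge s\}$. *)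

(* Defs.v *)
From HB Require Import structures.
From mathcomp.multinomials Require Import freeg.
From mathcomp Require Import all_boot all_order all_algebra.
From mathcomp Require Import all_classical all_reals all_analysis.
From mathcomp Require Import zify.
Import Order.TTheory GRing.Theory Num.Theory.
Import numFieldNormedType.Exports.

Set Implicit Arguments.
Unset Strict Implicit.
Unset Printing Implicit Defensive.

Local Open Scope classical_set_scope.
Local Open Scope ring_scope.
Local Open Scope quotient_scope.

Section Kernel.
Variables (K : pzRingType) (V W : lmodType K) (g : {linear V -> W}).

Definition kerp : {pred V} := [pred v | g v == 0].

Fact kerp_submod_closed : submod_closed kerp.
Proof.
split=> [|a u v]; first by rewrite inE linear0.
by rewrite !inE => /eqP gu /eqP gv; rewrite linearP gu gv scaler0 addr0.
Qed.
HB.instance Definition _ := GRing.isSubmodClosed.Build K V kerp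
  kerp_submod_closed.

Record ker := Ker { ker_val :> V; _ : ker_val \in kerp }.
HB.instance Definition _ := [isSub for ker_val].
HB.instance Definition _ := [Choice of ker by <:].
HB.instance Definition _ := [SubChoice_isSubLmodule of ker by <:].

End Kernel.

(* The homology ker g / im f of U --f--> V --g--> W at V, written as
   ker g / (im f `&` ker g) so that it makes sense before g \o f = 0 is known. *)
Section Homology.
Variables (K : pzRingType) (U V W : lmodType K).
Variables (f : {linear U -> V}) (g : {linear V -> W}).

Definition bdryp : {pred (ker g)} := [pred z | `[< exists u, f u = \val z >]].

Lemma bdrypP (z : ker g) : reflect (exists u, f u = \val z) (z \in bdryp).
Proof. by rewrite inE; exact: asboolP. Qed.

Fact bdryp_zmod_closed : zmod_closed bdryp.
Proof.
split=> [|y z /bdrypP[u yE] /bdrypP[v zE]].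
  by apply/bdrypP; exists 0; rewrite !linear0.
by apply/bdrypP; exists (u - v); rewrite linearB yE zE raddfB.
Qed.
HB.instance Definition _ := GRing.isZmodClosed.Build (ker g) bdryp
  bdryp_zmod_closed.

Definition homology := Quotient.quot bdryp.
HB.instance Definition _ := GRing.Zmodule.on homology.

Definition hclass (z : ker g) : homology := \pi z.
Definition hrepr (x : homology) : ker g := repr x.

Lemma hreprK : cancel hrepr hclass. Proof. exact: reprK. Qed.

Lemma hclass_surj x : exists z, x = hclass z.
Proof. by exists (hrepr x); rewrite hreprK. Qed.

Lemma hclass_eqP (y z : ker g) :
  hclass y = hclass z <-> exists u, \val y = \val z + f u.
Proof.
have -> : (hclass y = hclass z) <-> y - z \in bdryp.
  by rewrite Quotient.idealrBE; split => /eqP.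
split=> [/bdrypP[u fu]|[u yE]].
  by exists u; rewrite fu raddfB addrC subrK.
by apply/bdrypP; exists u; rewrite raddfB /= yE addrAC subrr add0r.
Qed.

Lemma hclass_hrepr (z : ker g) : exists u, \val (hrepr (hclass z)) = \val z + f u.
Proof. by apply/hclass_eqP; rewrite hreprK. Qed.

Fact hclass_zmod_morphism : zmod_morphism hclass.
Proof. exact: (raddfB \pi_homology). Qed.
HB.instance Definition _ := GRing.isZmodMorphism.Build (ker g) homology hclass
  hclass_zmod_morphism.

Definition hscale (a : K) (x : homology) : homology := hclass (a *: hrepr x).

Lemma hscaleE a z : hscale a (hclass z) = hclass (a *: z).
Proof.
apply/hclass_eqP; have [u uE] := hclass_hrepr z.
by exists (a *: u); rewrite !linearZ/= uE scalerDr.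
Qed.

Fact hscaleA a b x : hscale a (hscale b x) = hscale (a * b) x.
Proof. by have [z ->] := hclass_surj x; rewrite !hscaleE scalerA. Qed.

Fact hscale1 : left_id 1 hscale.
Proof. by move=> x; have [z ->] := hclass_surj x; rewrite hscaleE scale1r. Qed.

Fact hscaleDr : right_distributive hscale +%R.
Proof.
move=> a x y; have [z ->] := hclass_surj x; have [w ->] := hclass_surj y.
by rewrite -raddfD !hscaleE scalerDr raddfD.
Qed.

Fact hscaleDl x : {morph hscale^~ x : a b / a + b}.
Proof.
by move=> a b; have [z ->] := hclass_surj x; rewrite !hscaleE scalerDl raddfD.
Qed.

HB.instance Definition _ := GRing.Zmodule_isLmodule.Build K homology
  hscaleA hscale1 hscaleDr hscaleDl.

Fact hclass_scalable : scalable hclass.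
Proof. by move=> a z; rewrite -hscaleE. Qed.
HB.instance Definition _ := GRing.isScalable.Build K (ker g) homology *:%R
  hclass hclass_scalable.

End Homology.

Section CochainComplex.
Variables (K : pzRingType) (C : nat -> lmodType K).
Variable d : forall q, {linear C q -> C q.+1}.

Definition prev_term (q : nat) : lmodType K := if q is p.+1 then C p else C 0.

Definition prev_diff (q : nat) : {linear prev_term q -> C q} :=
  if q is p.+1 then d p else \0 : {linear C 0 -> C 0}.

Definition cohomology (q : nat) : lmodType K := homology (prev_diff q) (d q).

End CochainComplex.

Section Dimension.
Variables (K : fieldType) (V : lmodType K).

Definition lin_indep (B : set V) : Prop :=
  forall (r : seq V) (c : V -> K), uniq r -> [set` r] `<=` B ->
    \sum_(v <- r) c v *: v = 0 -> {in r, forall v, c v = 0}.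

Definition spanning (B : set V) : Prop :=
  forall w, exists (r : seq V) (c : V -> K),
    [set` r] `<=` B /\ w = \sum_(v <- r) c v *: v.

(* [dim_K V >= s], where V may be infinite-dimensional *)
Definition dim_ge (s : nat) : Prop :=
  exists B : set V, [/\ lin_indep B, spanning B & (`I_s #<= B)%card].

End Dimension.

Section Simplex.
Variable R : realType.

Definition std_simplex (n : nat) : set 'rV[R]_n.+1 :=
  [set x | (forall i, 0 <= x 0 i) /\ \sum_i x 0 i = 1].
Arguments std_simplex : clear implicits.

Definition simplex (n : nat) := set_type (std_simplex n).
HB.instance Definition _ n := Topological.on (simplex n).

Section AffineMap.
Variables (m n : nat) (th : 'I_m.+1 -> 'I_n.+1).

(* e_i |-> e_(th i) on vertices *)
Definition affine_map (x : 'rV[R]_m.+1) : 'rV[R]_n.+1 :=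
  \row_j \sum_(i | th i == j) x 0 i.

Lemma affine_map_simplex x :
  std_simplex m x -> std_simplex n (affine_map x).
Proof.
move=> [x_ge0 x1]; split=> [j|]; first by rewrite mxE sumr_ge0.
under eq_bigr do rewrite mxE.
by rewrite -x1 [RHS](partition_big th xpredT).
Qed.

Lemma affine_map_continuous : continuous affine_map.
Proof.
move=> x A [P Px PA].
have Fx : Filter (nbhs x) by exact: nbhs_filter.
have {}Px j : \forall y \near x, P 0 j (affine_map y 0 j).
  have cv : (\sum_(i | th i == j) (y : 'rV[R]_m.+1) 0 i) @[y --> x]
      --> (\sum_(i | th i == j) x 0 i).
    apply: cvg_big => [|i _]; first exact: add_continuous.
    exact: coord_continuous.
  have := Px 0 j; rewrite mxE => /cv; rewrite nbhs_simpl /=.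
  by apply: (@filterS _ (nbhs x)) => y; rewrite mxE.
have : \forall y \near x, forall j, P 0 j (affine_map y 0 j).
  exact: (@filter_forall _ _ (fun j y => P 0 j (affine_map y 0 j)) (nbhs x)).
apply: (@filterS _ (nbhs x)) => y Py.
by apply: PA => i j; rewrite ord1.
Qed.

Definition simplex_map (x : simplex m) : simplex n :=
  SigSub (mem_set (affine_map_simplex (set_mem (valP x)))).

Lemma simplex_map_continuous : continuous simplex_map.
Proof.
apply: continuous_comp_initial => x.
apply: (@continuous_comp _ _ _ set_val affine_map).
  exact: initial_continuous.
exact: affine_map_continuous.
Qed.
HB.instance Definition _ := isContinuous.Build (simplex m) (simplex n)
  simplex_map simplex_map_continuous.

End AffineMap.
End Simplex.


Lemma simplex_map_comp (R : realType) (l m n : nat) (th : 'I_l.+1 -> 'I_m.+1)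
    (ps : 'I_m.+1 -> 'I_n.+1) (x : simplex R l) :
  simplex_map ps (simplex_map th x) = simplex_map (ps \o th) x.
Proof.
apply/val_inj/rowP => j /=; rewrite !mxE.
under eq_bigr do rewrite mxE.
rewrite [RHS](partition_big th (fun i => ps i == j)) //=.
apply: eq_bigr => i /eqP psi; apply: eq_bigl => k.
by case: eqP => [->|]; rewrite ?andbF // psi eqxx.
Qed.

Section SingularSimplex.
Variables (R : realType) (X : topologicalType).

Definition sing (n : nat) := continuousType (simplex R n) X.
HB.instance Definition _ n := Choice.on (sing n).

Definition pull (m n : nat) (th : 'I_m.+1 -> 'I_n.+1) (s : sing n) : sing m :=
  s \o simplex_map th.

Lemma eq_pull m n (th ps : 'I_m.+1 -> 'I_n.+1) s :
  (forall i, th i = ps i :> nat) -> pull th s = pull ps s.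
Proof. by move=> e; have -> : th = ps by apply/funext => i; exact/val_inj/e. Qed.

Lemma pull_comp l m n (th : 'I_l.+1 -> 'I_m.+1) (ps : 'I_m.+1 -> 'I_n.+1) s :
  pull th (pull ps s) = pull (ps \o th) s.
Proof. by apply/continuousEP => x /=; rewrite simplex_map_comp. Qed.

Definition face (n : nat) (i : 'I_n.+2) (s : sing n.+1) : sing n :=
  pull (lift i) s.

End SingularSimplex.

Section Chains.
Variables (R : realType) (X : topologicalType).

Definition chain (n : nat) := {freeg (sing R X n) / int}.
HB.instance Definition _ n := GRing.Lmodule.on (chain n).

Definition bdry (n : nat) : chain n.+1 -> chain n :=
  fglift (fun s => \sum_(i < n.+2) (-1) ^+ i *: << face i s >>).

Fact bdry_linear n : linear (@bdry n).
Proof.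
have bdryB : {morph @bdry n : x y / x - y} by exact: lift_is_additive.
pose h := GRing.isZmodMorphism.Build _ _ (@bdry n) bdryB.
pose f : {additive chain n.+1 -> chain n} := HB.pack (@bdry n) h.
by move=> a x y; rewrite -[@bdry n]/(f : _ -> _) raddfD -[a]intz !scaler_int raddfMz.
Qed.
HB.instance Definition _ n := GRing.isLinear.Build int (chain n.+1) (chain n)
  *:%R (@bdry n) (@bdry_linear n).

Definition H1Z : lmodType int := homology (@bdry 1) (@bdry 0).

End Chains.

Section Cohomology.
Variables (R : realType) (X : topologicalType) (k : comNzRingType).

Definition cochain (n : nat) : lmodType k := sing R X n -> k^o.

Definition cobdry (n : nat) (c : cochain n) : cochain n.+1 :=
  fun s => \sum_(i < n.+2) (-1) ^+ i * c (face i s).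

Fact cobdry_linear n : linear (@cobdry n).
Proof.
move=> a c c'; apply/funext => s; rewrite /cobdry !fctE /GRing.scale /= mulr_sumr.
by rewrite -big_split; apply: eq_bigr => i _ /=; rewrite mulrDr mulrCA.
Qed.
HB.instance Definition _ n := GRing.isLinear.Build k (cochain n) (cochain n.+1)
  *:%R (@cobdry n) (@cobdry_linear n).

Lemma cobdry_cobdry n (c : cochain n) : cobdry (cobdry c) = 0.
Proof.
apply/funext => s; rewrite /cobdry.
pose G (i j : nat) : k :=
  (-1) ^+ (i + j) * c (pull (fun l => inord (bump i (bump j l))) s).
have GS (i j : nat) : (i <= j)%N -> G j.+1 i = - G i j.
  move=> ij; rewrite /G addSn exprS mulN1r mulNr addnC; congr (- (_ * c _)).
  by apply: eq_pull => l; congr (nat_of_ord (inord _)); rewrite /bump; lia.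
transitivity (\sum_(i < n.+3) \sum_(j < n.+2) G i j).
  apply: eq_bigr => i _; rewrite mulr_sumr; apply: eq_bigr => j _.
  rewrite mulrA -exprD /face pull_comp; congr (_ * c _).
  by apply: eq_pull => l; rewrite /= inordK //; exact: (ltn_ord (lift i (lift j l))).
under eq_bigr => i _ do rewrite (bigID (fun j : 'I_n.+2 => (i <= j)%N)) /=.
rewrite big_split /= big_ord_recr /= [X in _ + X + _]big1; last first.
  by move=> j; rewrite leqNgt ltn_ord.
rewrite addr0 [X in _ + X]big_ord_recl [X in _ + (X + _)]big1 ?add0r; last first.
  by move=> j; rewrite leq0n.
rewrite [X in _ + X](_ : _ =
    \sum_(i < n.+2) \sum_(j < n.+2 | (j <= i)%N) - G j i); last first.
  apply: eq_bigr => i _; apply: eq_big => j; first by rewrite lift0 -leqNgt.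
  by rewrite lift0 -ltnNge ltnS => /GS.
rewrite [X in _ + X](exchange_big_dep xpredT) //= -big_split big1 // => i _ /=.
by rewrite -big_split big1 // => j _; exact: subrr.
Qed.

Definition codiff (n : nat) : {linear cochain n -> cochain n.+1} := @cobdry n.
Definition cocycle (q : nat) : lmodType k := ker (codiff q).
Definition H (q : nat) : lmodType k := cohomology codiff q.

Lemma cocycleP n (c : cochain n) : cobdry c = 0 -> c \in kerp (codiff n).
Proof. by move=> dc; rewrite inE. Qed.

Lemma cobdry_cocycle n (z : cocycle n) : cobdry (\val z) = 0.
Proof. by apply/eqP; exact: (valP z). Qed.

(* The front p-face and the back q-face of an n-simplex, where n = p + q *)
Definition front (p n : nat) (i : 'I_p.+1) : 'I_n.+1 := inord i.
Definition back (p q n : nat) (i : 'I_q.+1) : 'I_n.+1 := inord (p + i).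

Definition cup_cochain (p q n : nat) (a : cochain p) (b : cochain q) :
    cochain n :=
  fun s => a (pull (@front p n) s) * b (pull (@back p q n) s).
Arguments cup_cochain {p q} n a b.

Lemma cup_cochainPl p q n (b : cochain q) c (a a' : cochain p) :
  cup_cochain n (c *: a + a') b = c *: cup_cochain n a b + cup_cochain n a' b.
Proof.
by apply/funext => s; rewrite /cup_cochain !fctE /GRing.scale /= mulrDl mulrA.
Qed.

Lemma cup_cochainPr p q n (a : cochain p) c (b b' : cochain q) :
  cup_cochain n a (c *: b + b') = c *: cup_cochain n a b + cup_cochain n a b'.
Proof.
by apply/funext => s; rewrite /cup_cochain !fctE /GRing.scale /= mulrDr mulrCA.
Qed.

Lemma cup_cochain0l p q n (b : cochain q) :
  cup_cochain n (0 : cochain p) b = 0.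
Proof. by apply/funext => s; rewrite /cup_cochain mul0r. Qed.

Lemma cup_cochain0r p q n (a : cochain p) :
  cup_cochain n a (0 : cochain q) = 0.
Proof. by apply/funext => s; rewrite /cup_cochain mulr0. Qed.

Lemma cup_leibniz p q n (a : cochain p) (b : cochain q) : n = (p + q)%N ->
  cobdry (cup_cochain n a b) =
  cup_cochain n.+1 (cobdry a) b + (-1) ^+ p *: cup_cochain n.+1 a (cobdry b).
Proof.
move=> nE; apply/funext => s.
rewrite !fctE /cobdry /cup_cochain /GRing.scale /=.
pose A (i : nat) : k := a (pull (fun l => inord (bump i l)) s).
pose B (r : nat) : k := b (pull (fun l => inord (r + l)) s).
pose F (i : nat) : k :=
  (-1) ^+ i * (A i * b (pull (fun l => inord (bump i (p + l))) s)).
pose D (j : nat) : k := b (pull (fun l => inord (p + bump j l)) s).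
transitivity (\sum_(0 <= i < n.+2) F i).
  rewrite big_mkord; apply: eq_bigr => i _; congr (_ * _).
  rewrite /face !pull_comp; congr (a _ * b _); apply: eq_pull => l;
    have := ltn_ord l => lP; rewrite /= /front /back !inordK // ?/bump; lia.
transitivity (\sum_(0 <= i < p.+2) (-1) ^+ i * A i * B p.+1 +
    (-1) ^+ p * (A p.+1 * \sum_(0 <= j < q.+2) (-1) ^+ j * D j)); last first.
  rewrite !big_mkord -mulr_suml; congr (_ * b _ + (-1) ^+ p * (a _ * _)).
  - apply: eq_bigr => i _; congr (_ * a _); rewrite /face pull_comp.
    apply: eq_pull => l; have := ltn_ord l; have := ltn_ord i => iP lP.
    by rewrite /= /front !inordK // /bump; lia.
  - apply: eq_pull => l; have := ltn_ord l => lP.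
    by rewrite /front !inordK // /bump; lia.
  - apply: eq_bigr => j _; congr (_ * b _); rewrite /face pull_comp.
    apply: eq_pull => l; have := ltn_ord l; have := ltn_ord j => jP lP.
    by rewrite /= /back !inordK // /bump; lia.
rewrite (@big_cat_nat _ _ _ p.+1) //=; last by lia.
rewrite [in RHS]big_nat_recr //= [X in _ * (_ * X)]big_nat_recl //=.
have -> : (-1) ^+ p.+1 * A p.+1 * B p.+1 =
    - ((-1) ^+ p * (A p.+1 * ((-1) ^+ 0 * D 0))).
  rewrite exprS expr0 mul1r mulN1r !mulNr mulrA; congr (- (_ * b _)).
  by apply: eq_pull => l; rewrite /bump addSn addnS.
rewrite !mulrDr addrA addrNK; congr (_ + _).
  apply: eq_big_nat => i iP; rewrite /F mulrA; congr (_ * b _).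
  by apply: eq_pull => l; congr (nat_of_ord (inord _)); rewrite /bump; lia.
rewrite -{1}[p.+1]add0n big_addn (_ : (n.+2 - p.+1)%N = q.+1); last by lia.
rewrite !mulr_sumr; apply: eq_big_nat => j jP.
rewrite /F [X in _ = _ * X]mulrCA [RHS]mulrA -exprD; congr (_ * (a _ * b _)).
- by congr (_ ^+ _); lia.
- apply: eq_pull => l; have := ltn_ord l => lP.
  by congr (nat_of_ord (inord _)); rewrite /bump; lia.
- by apply: eq_pull => l; congr (nat_of_ord (inord _)); rewrite /bump; lia.
Qed.

Fact cup_cocycle_subproof p q (a : cocycle p) (b : cocycle q) :
  cup_cochain (p + q) (\val a) (\val b) \in kerp (codiff (p + q)).
Proof.
apply: cocycleP; rewrite cup_leibniz // !cobdry_cocycle.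
by rewrite cup_cochain0l cup_cochain0r scaler0 addr0.
Qed.

Definition cup_cocycle p q (a : cocycle p) (b : cocycle q) : cocycle (p + q) :=
  Ker (cup_cocycle_subproof a b).

Lemma cup_prev_diffl p q u (b : cocycle q) : exists w,
  prev_diff codiff (p + q) w =
  cup_cochain (p + q) (prev_diff codiff p u) (\val b).
Proof.
case: p u => [|p] u; first by exists 0; rewrite linear0 cup_cochain0l.
exists (cup_cochain (p + q) u (\val b)).
by rewrite [LHS]cup_leibniz // cobdry_cocycle cup_cochain0r scaler0 addr0.
Qed.

Lemma cup_prev_diffr p q (a : cocycle p) v : exists w,
  prev_diff codiff (p + q) w =
  cup_cochain (p + q) (\val a) (prev_diff codiff q v).
Proof.
case: q v => [|q] v; first by exists 0; rewrite linear0 cup_cochain0r.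
move: (p + q.+1)%N (addnS p q) => _ ->.
exists ((-1) ^+ p *: cup_cochain (p + q) (\val a) v).
rewrite linearZ.
transitivity ((-1) ^+ p *: cobdry (cup_cochain (p + q) (\val a) v)) => //.
rewrite cup_leibniz // cobdry_cocycle cup_cochain0l add0r.
by rewrite scalerA -expr2 sqrr_sign scale1r.
Qed.

Definition cup p q (x : H p) (y : H q) : H (p + q) :=
  hclass _ (cup_cocycle (hrepr x) (hrepr y)).

Lemma cupE p q (a : cocycle p) (b : cocycle q) :
  cup (hclass _ a) (hclass _ b) = hclass _ (cup_cocycle a b).
Proof.
rewrite /cup; apply/hclass_eqP.
have [u uE] := hclass_hrepr (prev_diff codiff p) a.
have [v vE] := hclass_hrepr (prev_diff codiff q) b.
have [w wE] := cup_prev_diffl u (hrepr (hclass (prev_diff codiff q) b)).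
have [w' w'E] := cup_prev_diffr a v.
exists (w' + w); rewrite linearD w'E wE /= uE -[\val a]scale1r cup_cochainPl.
rewrite !scale1r addrA; congr (_ + _).
by rewrite vE -[\val b]scale1r cup_cochainPr !scale1r.
Qed.

Lemma cupPl p q (y : H q) : linear (fun x : H p => cup x y).
Proof.
move=> c x x'; have [a ->] := hclass_surj x; have [a' ->] := hclass_surj x'.
have [b ->] := hclass_surj y; rewrite -linearP !cupE -linearP; congr (hclass _ _).
by apply/val_inj; rewrite /= cup_cochainPl.
Qed.

Lemma cupPr p q (x : H p) : linear (fun y : H q => cup x y).
Proof.
move=> c y y'; have [b ->] := hclass_surj y; have [b' ->] := hclass_surj y'.
have [a ->] := hclass_surj x; rewrite -linearP !cupE -linearP; congr (hclass _ _).
by apply/val_inj; rewrite /= cup_cochainPr.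
Qed.

End Cohomology.
Arguments H : clear implicits.

Definition incl24 (x : 'F_2) : 'Z_4 := ((x : nat) * 2)%:R.
Definition red42 (x : 'Z_4) : 'F_2 := (x : nat)%:R.

Fact incl24_zmod_morphism : zmod_morphism incl24.
Proof. by case=> [[|[|?]] //= ?] [[|[|?]] //= ?]; exact/val_inj. Qed.
HB.instance Definition _ := GRing.isZmodMorphism.Build 'F_2 'Z_4 incl24
  incl24_zmod_morphism.

Fact red42_zmod_morphism : zmod_morphism red42.
Proof.
by case=> [[|[|[|[|?]]]] //= ?] [[|[|[|[|?]]]] //= ?]; exact/val_inj.
Qed.
HB.instance Definition _ := GRing.isZmodMorphism.Build 'Z_4 'F_2 red42
  red42_zmod_morphism.

Lemma incl24_inj : injective incl24.
Proof. by case=> [[|[|?]] //= ?] [[|[|?]] //= ?] // _; exact/val_inj. Qed.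

Lemma red42_incl24 x : red42 (incl24 x) = 0.
Proof. by case: x => [[|[|?]] //= ?]; exact/val_inj. Qed.

Definition lift24 (x : 'F_2) : 'Z_4 := (x : nat)%:R.
Definition half42 (x : 'Z_4) : 'F_2 := ((x : nat)./2)%:R.

Lemma lift24K : cancel lift24 red42.
Proof. by case=> [[|[|?]] //= ?]; exact/val_inj. Qed.

Lemma incl24_half x : red42 x = 0 -> incl24 (half42 x) = x.
Proof. by case: x => [[|[|[|[|?]]]] //= ?] //; move=> _; exact/val_inj. Qed.

Section Bockstein.
Variables (R : realType) (X : topologicalType).
Local Notation C2 := (cochain R X 'F_2).
Local Notation C4 := (cochain R X 'Z_4).

Lemma cobdry_comp (k l : comNzRingType) (f : {additive k -> l}) n
    (c : cochain R X k n) :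
  cobdry (k := l) (f \o c) = f \o cobdry c.
Proof.
apply/funext => s; rewrite /cobdry /= raddf_sum; apply: eq_bigr => i _ /=.
by rewrite -!(signr_odd _ i) !mulr_sign; case: odd; rewrite ?raddfN.
Qed.

Definition bockstein_cochain q (c : C2 q) : C2 q.+1 :=
  half42 \o cobdry (lift24 \o c : C4 q).

Lemma bockstein_cochainE q (z : cocycle R X 'F_2 q) :
  incl24 \o bockstein_cochain (\val z) = cobdry (lift24 \o \val z : C4 q).
Proof.
apply/funext => s; apply: incl24_half.
rewrite -[LHS]/((red42 \o cobdry (lift24 \o \val z : C4 q)) s).
have <- := cobdry_comp red42 (lift24 \o \val z : C4 q).
have -> : red42 \o (lift24 \o \val z) = \val z :> C2 q.
  by apply/funext => t; exact: lift24K.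
by rewrite cobdry_cocycle.
Qed.

Fact bockstein_cocycle_subproof q (z : cocycle R X 'F_2 q) :
  bockstein_cochain (\val z) \in kerp (codiff R X 'F_2 q.+1).
Proof.
apply/cocycleP/funext => s; apply: incl24_inj.
have := cobdry_comp incl24 (bockstein_cochain (\val z)).
rewrite bockstein_cochainE cobdry_cobdry => /(congr1 (fun f => f s)) /= <-.
by rewrite raddf0.
Qed.

Definition bockstein_cocycle q (z : cocycle R X 'F_2 q) :
    cocycle R X 'F_2 q.+1 :=
  Ker (bockstein_cocycle_subproof z).

Definition bockstein q (x : H R X 'F_2 q) : H R X 'F_2 q.+1 :=
  hclass _ (bockstein_cocycle (hrepr x)).

Lemma prev_diff_lift q u : exists c : C4 q,
  cobdry c = 0 /\ red42 \o c = prev_diff (codiff R X 'F_2) q u.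
Proof.
case: q u => [|q] u.
  by exists 0; rewrite linear0; split=> //; apply/funext => s; exact: raddf0.
exists (cobdry (lift24 \o u : C4 q)); rewrite cobdry_cobdry -cobdry_comp.
by split=> //; congr cobdry; apply/funext => s; exact: lift24K.
Qed.

(* [bockstein] is the connecting map: [c] lifts [z] to Z_4, and [w] is mapped
   to the coboundary of [c] by Z_2 -> Z_4. *)
Lemma bocksteinE q (z : cocycle R X 'F_2 q) (c : C4 q)
    (w : cocycle R X 'F_2 q.+1) :
  red42 \o c = \val z -> incl24 \o \val w = cobdry c ->
  bockstein (hclass _ z) = hclass _ w.
Proof.
move=> cz wc; apply/hclass_eqP.
have [u uE] := hclass_hrepr (prev_diff (codiff R X 'F_2) q) z.
have [c' [dc' c'E]] := prev_diff_lift u.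
set y := hrepr _ in uE *.
pose e0 : C4 q := (lift24 \o \val y : C4 q) - (c + c').
pose e : C2 q := half42 \o e0.
have eE : incl24 \o e = e0.
  apply/funext => s; apply: incl24_half; rewrite /e0 !fctE raddfB raddfD.
  have /(congr1 (fun f => f s)) /= -> := cz.
  have /(congr1 (fun f => f s)) /= -> := c'E.
  have /(congr1 (fun f => f s)) /= := uE.
  by rewrite fctE => <-; rewrite lift24K subrr.
exists e; apply/funext => s; apply: incl24_inj.
have /(congr1 (fun f => f s)) /= -> := bockstein_cochainE y.
rewrite fctE raddfD.
have /(congr1 (fun f => f s)) /= -> := wc.
have /(congr1 (fun f => f s)) /= <- := cobdry_comp incl24 e.
have -> : cobdry (incl24 \o e) = cobdry (lift24 \o \val y : C4 q) - cobdry c.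
  by rewrite eE (linearB (codiff R X 'Z_4 q)) linearD /= dc' addr0.
by rewrite [RHS]addrC [in RHS]fctE subrK.
Qed.

Fact bockstein_additive q : {morph @bockstein q : x y / x + y}.
Proof.
move=> x y; have [z ->] := hclass_surj x; have [w ->] := hclass_surj y.
pose z' := hrepr (hclass (prev_diff (codiff R X 'F_2) q) z).
pose w' := hrepr (hclass (prev_diff (codiff R X 'F_2) q) w).
transitivity (bockstein (hclass (prev_diff _ q) z' + hclass _ w')).
  by rewrite !hreprK.
rewrite -raddfD -[RHS]raddfD.
apply: (@bocksteinE _ _ ((lift24 \o \val z' : C4 q) + (lift24 \o \val w' : C4 q))).
  by apply/funext => s; rewrite /= !fctE raddfD /= !lift24K.
rewrite (linearD (codiff R X 'Z_4 q)) /= -!bockstein_cochainE.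
by apply/funext => s; rewrite /= !fctE raddfD.
Qed.

Fact bockstein_linear q : linear (@bockstein q).
Proof.
have b0 : bockstein 0 = 0 :> H R X 'F_2 q.+1.
  by apply: (addrI (bockstein 0)); rewrite -bockstein_additive !addr0.
move=> a x y; rewrite bockstein_additive; congr (_ + _).
have [-> | ->] : a = 0 \/ a = 1.
- by case: a => [[|[|//]] ?]; [left|right]; exact/val_inj.
- by rewrite !scale0r.
- by rewrite !scale1r.
Qed.
HB.instance Definition _ q := GRing.isLinear.Build 'F_2 (H R X 'F_2 q)
  (H R X 'F_2 q.+1) *:%R (@bockstein q) (@bockstein_linear q).

End Bockstein.

Section Resonance.
Variables (R : realType) (X : topologicalType).
Local Notation A := (H R X 'F_2).

Definition delta (a : A 1) (q : nat) (u : A q) : A q.+1 := cup a u.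

HB.instance Definition _ a q := GRing.isLinear.Build 'F_2 (A q) (A q.+1) *:%R
  (delta a (q := q)) (cupPr a).

Definition bdelta (a : A 1) (q : nat) (u : A q) : A q.+1 :=
  cup a u + bockstein u.

Fact bdelta_linear a q : linear (@bdelta a q).
Proof.
move=> c u v; rewrite /bdelta [cup _ _]cupPr linearP scalerDr.
by rewrite addrACA.
Qed.
HB.instance Definition _ a q := GRing.isLinear.Build 'F_2 (A q) (A q.+1) *:%R
  (@bdelta a q) (@bdelta_linear a q).

Definition delta_diff (a : A 1) (q : nat) : {linear A q -> A q.+1} :=
  @delta a q.
Definition bdelta_diff (a : A 1) (q : nat) : {linear A q -> A q.+1} :=
  @bdelta a q.

Definition resonance (q s : nat) : set (A 1) :=
  [set a | dim_ge (cohomology (delta_diff a) q) s].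

Definition bockstein_resonance (q s : nat) : set (A 1) :=
  [set a | dim_ge (cohomology (bdelta_diff a) q) s].

End Resonance.
Arguments resonance : clear implicits.
Arguments bockstein_resonance : clear implicits.

Section CW.
Variables (R : realType) (X : topologicalType).

Definition disk (n : nat) : set 'rV[R]_n := [set x | \sum_i x 0 i ^+ 2 <= 1].
Definition open_disk (n : nat) : set 'rV[R]_n :=
  [set x | \sum_i x 0 i ^+ 2 < 1].
Definition sphere (n : nat) : set 'rV[R]_n :=
  [set x | \sum_i x 0 i ^+ 2 = 1].

Arguments disk : clear implicits.
Arguments open_disk : clear implicits.
Arguments sphere : clear implicits.

Record cw_structure := CWStructure {
  cw_hausdorff : hausdorff_space X;
  cell : nat -> Type;
  char_map : forall n, cell n -> 'rV[R]_n -> X;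
  char_map_continuous : forall n (i : cell n),
    {within disk n, continuous (char_map i)};
  (* [cell_cover] and [cell_inj]: X is the disjoint union of the open cells, and
     each characteristic map is injective on the open disk *)
  cell_cover : forall x : X, exists n (i : cell n) v,
    open_disk n v /\ char_map i v = x;
  cell_inj : forall n (i : cell n) v n' (i' : cell n') v',
    open_disk n v -> open_disk n' v' -> char_map i v = char_map i' v' ->
    existT (fun m => (cell m * 'rV[R]_m)%type) n (i, v) =
    existT (fun m => (cell m * 'rV[R]_m)%type) n' (i', v');
  cell_boundary : forall n (i : cell n),
    exists E : set {m : nat & cell m},
      [/\ finite_set E, forall e, E e -> (tag e < n)%N &
        char_map i @` sphere n `<=`
          \bigcup_(e in E) (char_map (tagged e) @` open_disk (tag e))];
  cell_weak : forall A : set X,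
    (forall n (i : cell n), closed (A `&` char_map i @` disk n)) -> closed A
}.

Definition finite_type (cw : cw_structure) : Prop :=
  forall n, finite_set [set: cell cw n].

End CW.

(* Main.v *)
(* The Bockstein of a class in degree at most 1 vanishes, so the two
   differentials agree on [A^0] and [A^1], hence have the same [H^1]. In degree 0
   the lift of a cocycle to [Z_4] is again a cocycle. In degree 1, the group of
   1-chains modulo boundaries has no 2-torsion (its quotient by [H_1] embeds in
   the 0-chains), and every homomorphism from such a group to [Z_2] lifts to
   [Z_4]; a lift of a cocycle obtained in this way is a cocycle over [Z_4]. *)
From HB Require Import structures.
Require Import Defs.
From mathcomp.multinomials Require Import freeg.
From mathcomp Require Import all_boot all_order all_algebra.
From mathcomp Require Import all_classical all_reals all_analysis.
Import Order.TTheory GRing.Theory Num.Theory.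
Local Open Scope classical_set_scope.
Local Open Scope ring_scope.

(** * Partial homomorphisms as subgroups of a product, and Zorn's lemma *)

Definition subgroup_set (U : zmodType) (G : set U) :=
  G 0 /\ forall x y, G x -> G y -> G (x - y).

Lemma subgroup_setN (U : zmodType) (G : set U) x :
  subgroup_set U G -> G x -> G (- x).
Proof. by move=> [G0 GB] Gx; rewrite -[- x]add0r; exact: GB. Qed.

Lemma subgroup_setD (U : zmodType) (G : set U) x y :
  subgroup_set U G -> G x -> G y -> G (x + y).
Proof.
by move=> sG Gx Gy; rewrite -[y]opprK; apply: sG.2 => //; exact: subgroup_setN.
Qed.

Lemma subgroup_set_bigcup (U : zmodType) (F : set (set U)) :
  F !=set0 -> (forall G, F G -> subgroup_set U G) -> total_on F subset ->
  subgroup_set U (\bigcup_(G in F) G).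
Proof.
move=> [G0 FG0] Fsub Ftot; split=> [|x y [G FG Gx] [G' FG' G'y]].
  by exists G0 => //; have [] := Fsub _ FG0.
have [GG'|G'G] := Ftot _ _ FG FG'.
  by exists G' => //; apply: (Fsub _ FG').2 => //; exact: GG'.
by exists G => //; apply: (Fsub _ FG).2 => //; exact: G'G.
Qed.

(** A subgroup of [V * W] meeting [0 * W] only in 0 is the graph of a homomorphism from a subgroup
    of [V] to [W]. Zorn's lemma thus extends the partial homomorphism [D] as far as possible. *)
Lemma maximal_functional_subgroup (V W : zmodType) (D : set (V * W)) :
  subgroup_set _ D -> (forall y, D (0, y) -> y = 0) ->
  exists G : set (V * W), [/\ subgroup_set _ G, D `<=` G,
    forall y, G (0, y) -> y = 0 &
    forall G', subgroup_set _ G' -> G `<=` G' ->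
      (forall y, G' (0, y) -> y = 0) -> G' `<=` G].
Proof.
move=> sD fD.
(* Zorn's lemma also asks for a bound of the empty chain, hence the union with [D]. *)
pose P G := subgroup_set _ (D `|` G) /\ forall y, (D `|` G) (0, y) -> y = 0.
have [F FP Ftot|G [[sG fG] Gmax]] := @Zorn_bigcup _ P.
  have [F0|/set0P Fn0] := eqVneq F set0.
    by rewrite F0 bigcup_set0 /P setU0.
  pose F' := [set D `|` G | G in F].
  have UE : D `|` \bigcup_(G in F) G = \bigcup_(G in F') G.
    rewrite bigcup_image; have [G0 FG0] := Fn0.
    apply/seteqP; split=> [x [Dx|[G FG Gx]]|x [G FG [Dx|Gx]]].
    - by exists G0 => //; left.
    - by exists G => //; right.
    - by left.
    - by right; exists G.
  rewrite /P UE; split=> [|y [_ [G FG <-]]]; last exact: (FP _ FG).2.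
  apply: subgroup_set_bigcup.
  - by have [G0 FG0] := Fn0; exists (D `|` G0), G0.
  - by move=> _ [G FG <-]; exact: (FP _ FG).1.
  - move=> _ _ [G FG <-] [G' FG' <-].
    by have [FGG'|FG'G] := Ftot _ _ FG FG'; [left | right]; exact: setUS.
exists (D `|` G); split=> // G' sG' GG' fG'.
have DG' : D `|` G' = G'.
  by apply: setUidr => x Dx; apply: GG'; left.
move=> x G'x; apply: contrapT => nGx; apply: (Gmax G'); last by rewrite /P DG'.
split=> [y Gy|]; first by apply: GG'; right.
by move=> /(_ _ G'x) Gx; apply: nGx; right.
Qed.

(** * Lifting homomorphisms from ['F_2] to ['Z_4] *)

Lemma lift24_double (x : 'F_2) : lift24 x *+ 2 = incl24 x.
Proof. by case: x => [[|[|?]] //= ?]; exact/val_inj. Qed.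

Lemma incl24_red42 (x : 'Z_4) : incl24 (red42 x) = x *+ 2.
Proof. by case: x => [[|[|[|[|?]]]] //= ?]; exact/val_inj. Qed.

(* [2 v |-> 2 z v] is well defined modulo [N] because [V / N] has no 2-torsion.
   Any extension [psi] of it satisfies [2 psi v = 2 z v], i.e. reduces to [z];
   one exists since a new [v] can be sent to any [t] with [2 t = 2 z v]. *)
Lemma additive_lift42 (V : zmodType) (N : set V) (z : V -> 'F_2) :
  subgroup_set _ N -> (forall v, N (v *+ 2) -> N v) ->
  zmod_morphism z -> (forall v, N v -> z v = 0) ->
  exists psi : V -> 'Z_4, [/\ zmod_morphism psi, forall v, N v -> psi v = 0 &
    forall v, red42 (psi v) = z v].
Proof.
move=> sN N2 zB zN.
have z0 : z 0 = 0 by rewrite -(subrr 0) zB subrr.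
pose D : set (V * 'Z_4) :=
  [set p | exists n v, [/\ N n, p.1 = n + v *+ 2 & p.2 = incl24 (z v)]].
have sD : subgroup_set _ D.
  split=> [|x y [n [v [Nn x1 x2]]] [n' [v' [Nn' y1 y2]]]].
    exists 0, 0; rewrite z0 raddf0 mul0rn addr0; split=> //; exact: sN.1.
  exists (n - n'), (v - v'); split; first exact: sN.2.
    by rewrite /= x1 y1 mulrnBl opprD addrACA.
  by rewrite /= x2 y2 zB raddfB.
(* If [n + 2 v = 0], then [2 v] lies in [N], hence so does [v], and [z] vanishes there. *)
have fD y : D (0, y) -> y = 0.
  move=> [n [v [Nn /= /esym nv ->]]]; rewrite zN ?raddf0 //; apply: N2.
  have -> : v *+ 2 = - n by apply: (addrI n); rewrite nv subrr.
  exact: subgroup_setN.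
have [G [sG DG fG Gmax]] := maximal_functional_subgroup _ _ _ sD fD.
have G2 v : G (v *+ 2, incl24 (z v)).
  by apply: DG; exists 0, v; rewrite add0r; split=> //; exact: sN.1.
have /choice[psi Gpsi] v : exists t, G (v, t).
  apply: contrapT => nGv; pose t := lift24 (z v).
  have Gvt : G ((v, t) + (v, t)).
    by have := G2 v; rewrite -lift24_double.
  (* Adding a single coset of [G] gives a subgroup because [2 (v, t)] already lies in [G]. *)
  pose G' : set (V * 'Z_4) := [set p | G p \/ G (p - (v, t))].
  suff Gvt' : G (v, t) by apply: nGv; exists t.
  apply: (Gmax G').
  - split=> [|x y]; first by left; exact: sG.1.
    move=> [Gx|Gx] [Gy|Gy].
    + by left; exact: sG.2.
    + right; have -> : x - y - (v, t) = x - (y - (v, t)) - ((v, t) + (v, t)).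
        by rewrite !opprD !opprK !addrA addrK.
      by apply: sG.2 => //; exact: sG.2.
    + by right; rewrite addrAC; exact: sG.2.
    + left; have -> : x - y = (x - (v, t)) - (y - (v, t)).
        by rewrite opprD opprK addrA [RHS]addrAC addrNK.
      exact: sG.2.
  - by move=> x Gx; left.
  (* If [(0, y)] were in the new coset, [G] would already give [v] the value [t - y]. *)
  - move=> y [/fG //|Gy]; exfalso; apply: nGv; exists (t - y).
    have -> : (v, t - y) = - ((0, y) - (v, t)).
      by rewrite opprB; congr (_, _); rewrite /= subr0.
    exact: subgroup_setN.
  - by right; rewrite subrr; exact: sG.1.
have psiE v y : G (v, y) -> y = psi v.
  move=> Gy; apply/eqP; rewrite -subr_eq0; apply/eqP; apply: fG.
  have <- : (v, y) - (v, psi v) = (0, y - psi v).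
    by congr (_, _); rewrite /= subrr.
  exact: sG.2.
have psiB : zmod_morphism psi.
  by move=> x y; apply/esym/psiE; exact: sG.2 (Gpsi x) (Gpsi y).
exists psi; split=> // v.
  move=> Nv; apply/esym/psiE/DG; exists v, 0.
  by rewrite mul0rn addr0 z0 raddf0.
apply: incl24_inj; rewrite incl24_red42 (psiE _ _ (G2 v)).
apply/psiE; exact: (subgroup_setD _ _ _ _ sG (Gpsi v) (Gpsi v)).
Qed.

(** * Extensionality, and homomorphisms out of free abelian groups *)

Lemma linear_ext (K : pzRingType) (V W : lmodType K) (f g : {linear V -> W}) :
  f =1 g -> f = g.
Proof.
case: f g => [f [[fA] [fS]]] [g [[gA] [gS]]] /= /funext fg.
move: fA fS gA gS; rewrite -fg => fA fS gA gS.
by rewrite (Prop_irrelevance fA gA) (Prop_irrelevance fS gS).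
Qed.

Lemma zmod_morphism_comp (U V W : zmodType) (f : V -> W) (g : U -> V) :
  zmod_morphism f -> zmod_morphism g -> zmod_morphism (f \o g).
Proof. by move=> fB gB x y; rewrite /= gB fB. Qed.

Lemma freeg_additive_ext (W : zmodType) (K : choiceType)
    (f g : {freeg K / int} -> W) :
  zmod_morphism f -> zmod_morphism g -> (forall s, f << s >> = g << s >>) ->
  f =1 g.
Proof.
move=> fB gB fg D.
pose f' : {additive _ -> _} := HB.pack f (GRing.isZmodMorphism.Build _ _ f fB).
pose g' : {additive _ -> _} := HB.pack g (GRing.isZmodMorphism.Build _ _ g gB).
rewrite -[f D]/(f' D) -[g D]/(g' D) -[D]freeg_sumE !raddf_sum.
apply: eq_bigr => s _; rewrite -[coeff s D]intz -freegU_mulz.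
by rewrite !raddfMz; congr (_ *~ _); exact: fg.
Qed.

Lemma freeg_additive_extension (W : zmodType) (K : choiceType) (g : K -> W) :
  exists f : {freeg K / int} -> W,
    zmod_morphism f /\ forall s, f << s >> = g s.
Proof.
(* [zmodule W] is [W] with its canonical module structure over [int], which [fglift] needs. *)
exists (fglift (g : K -> zmodule W)); split.
  exact: (@lift_is_additive _ _ (zmodule W)).
by move=> s; rewrite liftU scale1r.
Qed.

(** * Duality between singular chains and cochains *)

Section ChainFunctionals.
Context (R : realType) (X : topologicalType).

Lemma cobdry_functional (k : comNzRingType) n (f : chain R X n -> k) :
  zmod_morphism f ->
  cobdry (fun s => f << s >>) = (fun s => f (bdry << s >>)).
Proof.
move=> fB; apply/funext => s.
pose f' : {additive _ -> _} := HB.pack f (GRing.isZmodMorphism.Build _ _ f fB).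
rewrite /bdry liftU scale1r -[RHS]/(f' _) raddf_sum; apply: eq_bigr => i _.
(* The signs live in [k] on one side and in [int] on the other; both depend only on the parity of
   [i]. *)
rewrite -!(signr_odd _ i); case: odd.
  by rewrite !expr1 mulN1r scaleN1r raddfN.
by rewrite !expr0 mul1r scale1r.
Qed.

Lemma bdry_zmod_morphism n : zmod_morphism (@bdry R X n).
Proof. exact: raddfB. Qed.

Lemma cocycle_functional (k : comNzRingType) n (f : chain R X n -> k) :
  zmod_morphism f -> cobdry (fun s => f << s >>) = 0 ->
  forall x, f (bdry x) = 0.
Proof.
move=> fB df.
apply: (@freeg_additive_ext _ _ (f \o @bdry R X n) (fun=> 0)).
- by apply: zmod_morphism_comp => //; exact: bdry_zmod_morphism.
- by move=> x y; rewrite subrr.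
- by move=> s; have /(congr1 (@^~ s)) := df; rewrite cobdry_functional.
Qed.

(** Dual to [cobdry_cobdry] over [int]: the coefficient functionals [coeff t] separate chains. *)
Lemma bdry_bdry n (x : chain R X n.+2) : bdry (bdry x) = 0.
Proof.
apply/eqP/freeg_eqP => t; rewrite coeff0.
have coeffB : zmod_morphism (coeff t : chain R X n -> int).
  exact: coeffB.
apply: (@cocycle_functional int n.+1 (coeff t \o @bdry R X n)).
  by apply: zmod_morphism_comp => //; exact: bdry_zmod_morphism.
have <- := cobdry_functional _ _ _ coeffB.
exact: cobdry_cobdry.
Qed.

Lemma chain_double_eq0 n (x : chain R X n) : x *+ 2 = 0 -> x = 0.
Proof.
move=> x2; apply/eqP/freeg_eqP => t; rewrite coeff0; apply/eqP.
by have /eqP := congr1 (coeff t) x2; rewrite coeffMn coeff0 mulrn_eq0.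
Qed.

(** Since 0-chains are torsion-free, [v] is a cycle; its class in [H1Z] is killed by 2, hence
    zero. *)
Lemma bdry_double (H1_no_2torsion : forall x : H1Z R X, x *+ 2 = 0 -> x = 0)
    (v : chain R X 1) :
  (exists c, bdry c = v *+ 2) -> exists c, bdry c = v.
Proof.
move=> [c cv].
have dv : bdry v = 0.
  by apply: chain_double_eq0; rewrite -raddfMn -cv; exact: bdry_bdry.
have vP : v \in kerp (@bdry R X 0) by rewrite inE; apply/eqP.
have h0 : hclass (@bdry R X 1) (0 : ker (@bdry R X 0)) = 0 by exact: raddf0.
have : hclass (@bdry R X 1) (Ker vP) = hclass _ 0.
  rewrite h0; apply: H1_no_2torsion; rewrite -raddfMn -h0.
  by apply/hclass_eqP; exists c; rewrite [RHS]add0r [RHS]cv raddfMn.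
by move=> /hclass_eqP[u uE]; exists u; rewrite -[LHS]add0r; exact/esym/uE.
Qed.

(** * Vanishing of the Bockstein in degrees 0 and 1 *)

Lemma bockstein_lift q (z : cocycle R X 'F_2 q) (c : cochain R X 'Z_4 q) :
  red42 \o c = \val z -> cobdry c = 0 -> bockstein (hclass _ z) = 0.
Proof.
move=> cz dc; rewrite (bocksteinE (w := 0) cz); first exact: raddf0.
by rewrite dc; apply/funext => s; exact: raddf0.
Qed.

Lemma bockstein0_eq0 (x : H R X 'F_2 0) : bockstein x = 0.
Proof.
have [z ->] := hclass_surj x; apply: (bockstein_lift _ _ (lift24 \o \val z)).
  by apply/funext => s; exact: lift24K.
(* A 0-cocycle takes equal values at the two ends of a 1-simplex, so its pointwise lift does too. *)
apply/funext => s; have /(congr1 (@^~ s)) := cobdry_cocycle z.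
rewrite /cobdry !big_ord_recl !big_ord0 !expr0 !expr1 !mul1r !addr0 !mulN1r.
by move=> /eqP; rewrite subr_eq0 => /eqP /= ->; rewrite subrr.
Qed.

Lemma bockstein1_eq0 (H1_no_2torsion : forall x : H1Z R X, x *+ 2 = 0 -> x = 0)
    (x : H R X 'F_2 1) : bockstein x = 0.
Proof.
have [z ->] := hclass_surj x.
have [f [fB fU]] := freeg_additive_extension _ _ (\val z : sing R X 1 -> 'F_2).
(* Here [N] is the group of 1-boundaries: [f] kills it because [z] is a cocycle, and so does the
   lift [psi], which makes [psi] a cocycle over ['Z_4]. *)
have [|v|v [c <-]|psi [psiB psi0 psif]] :=
    @additive_lift42 _ [set v | exists c : chain R X 2, bdry c = v] f _ _ fB.
- split=> [|_ _ [c <-] [c' <-]]; first by exists 0; rewrite raddf0.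
  by exists (c - c'); rewrite raddfB.
- exact: bdry_double.
- apply: cocycle_functional => //; rewrite -[RHS](cobdry_cocycle z).
  by congr cobdry; apply/funext.
apply: (bockstein_lift _ _ (fun s => psi << s >>)).
  by apply/funext => s; rewrite /= psif fU.
rewrite cobdry_functional //; apply/funext => s.
by apply: psi0; exists << s >>.
Qed.

End ChainFunctionals.

Theorem lemma6p13 (R : realType) (X : topologicalType)
    (cw : cw_structure R X) (cw_fin : finite_type cw)
    (X_nonempty : [set: X] !=set0) (X_conn : connected [set: X])
    (H1_no_2torsion : forall x : H1Z R X, x *+ 2 = 0 -> x = 0) (s : nat) :
  resonance R X 1 s = bockstein_resonance R X 1 s.
Proof.
apply/funext => a; rewrite /resonance /bockstein_resonance /=.
have d0 : delta_diff a 0 = bdelta_diff a 0.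
  by apply: linear_ext => u; rewrite /= /bdelta bockstein0_eq0 addr0.
have d1 : delta_diff a 1 = bdelta_diff a 1.
  by apply: linear_ext => u; rewrite /= /bdelta bockstein1_eq0 ?addr0.
by rewrite /cohomology /= d0 d1.
Qed.
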